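(* Let $(G,*_1,*_2,\ldots,*_n)$ be an $n$-multi-group and let $e_k$ denote the unit element of the group $(G,*_k)$. If $e_i=e_j$ for some $i,j\in\{1,2,\ldots,n\}$, then the operations $*_i$ and $*_j$ coincide: $*_i=*_j$.
   Context: An $n$-multi-group is a set $G$ with $n$ binary operations $*_1,\dots,*_n$ such that each $(G,*_i)$ is a group and the mixed associativity axioms hold: $$(a *_i b) *_j c = a *_i (b *_j c)\qquad\text{for all } a,b,c\in G \text{ and all } i,j\in\{1,\dots,n\}.$$ *)

(* Defs.v *)
From mathcomp Require Import all_boot.

Set Implicit Arguments.
Unset Strict Implicit.
Unset Printing Implicit Defensive.

(* [groupType] fixes a single operation per carrier and requires a choice
   structure on it; here one arbitrary set carries several group laws, so being
   a group is stated as a predicate on the operation. *)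

Definition is_unit_element (G : Type) (op : G -> G -> G) (e : G) : Prop :=
  left_id e op /\ right_id e op.

Definition is_group (G : Type) (op : G -> G -> G) : Prop :=
  associative op /\
  exists e : G, is_unit_element op e /\
    forall x : G, exists y : G, op y x = e /\ op x y = e.

(* The operations are indexed by 'I_n, i.e. from 0 to n - 1. *)
Record is_multi_group (n : nat) (G : Type) (op : 'I_n -> G -> G -> G) : Prop :=
  IsMultiGroup {
    multi_group_group : forall i : 'I_n, is_group (op i);
    multi_group_mixedA : forall (i j : 'I_n) (a b c : G),
      op j (op i a b) c = op i a (op j b c)
  }.

(* Main.v *)
Require Import Defs.
From mathcomp Require Import all_boot.
From Stdlib Require Import FunctionalExtensionality.

Theorem proposition2p3 (n : nat) (G : Type) (op : 'I_n -> G -> G -> G)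
    (e : 'I_n -> G)
    (multi_group_op : is_multi_group op)
    (unit_e : forall k : 'I_n, is_unit_element (op k) (e k))
    (i j : 'I_n) (eq_e : e i = e j) :
  op i = op j.
Proof.
have [_ right_unit_i] := unit_e i; have [left_unit_j _] := unit_e j.
apply: functional_extensionality => a; apply: functional_extensionality => b.
(* Mixed associativity lets the common unit be inserted between a and b as a
   left unit for the j-th law and absorbed as a right unit for the i-th:
   a *_i b = a *_i (e *_j b) = (a *_i e) *_j b = a *_j b. *)
by rewrite -{1}(left_unit_j b) -(multi_group_mixedA multi_group_op) -eq_e
  right_unit_i.
Qed.
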